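(* Let $n$ be a positive integer. Then there is a natural isomorphism between the functors $MC_n:\mathfrak{R}\to\mathfrak{R}$ and $MC_n^2=MC_n\circ MC_n:\mathfrak{R}\to\mathfrak{R}$.
   Context: All rings are associative with $1$; ring morphisms preserve $1$; $\mathfrak{R}$ is the category of rings. $M_m(R)$ is the ring of $m\times m$ matrices over $R$, and for a ring morphism $f:R\to S$, $M_m(f):M_m(R)\to M_m(S)$ applies $f$ entrywise. For $n\ge 1$ let $\eta^n_R:R\to M_n(R)$, $\eta^n_R(a)_{ij}=a\delta_{ij}$ (scalar matrices). Identify $M_n(M_{n^k}(R))$ with $M_{n^{k+1}}(R)$ via block matrices. For $n$ fixed, consider the direct system indexed by $k\in\mathbb{N}=\{0,1,2,\dots\}$ with objects $M_{n^k}(R)$ (so $M_{n^0}(R)=R$) and connecting maps $\eta^n_{M_{n^k}(R)}:M_{n^k}(R)\to M_{n^{k+1}}(R)$ (sending $A$ to the block diagonal matrix with $n$ diagonal blocks equal to $A$) and their composites. The $n$-matricial closure $MC_n(R)$ is the direct limit of this system in $\mathfrak{R}$, with canonical morphisms $i[R]^n_k:M_{n^k}(R)\to MC_n(R)$. For a ring morphism $f:R\to S$, $MC_n(f):MC_n(R)\to MC_n(S)$ is the unique ring morphism with $MC_n(f)\circ i[R]^n_k=i[S]^n_k\circ M_{n^k}(f)$ for all $k\in\mathbb{N}$. This makes $MC_n$ a functor $\mathfrak{R}\to\mathfrak{R}$. *)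

(* Defs.v *)
From HB Require Import structures.
From mathcomp Require Import all_boot all_order all_algebra.
From mathcomp Require Import boolp.

Set Implicit Arguments.
Unset Strict Implicit.
Unset Printing Implicit Defensive.

Import GRing.Theory.
Local Open Scope ring_scope.
Local Open Scope quotient_scope.

(* The category of rings is rendered by [pzRingType] (unital associative      *)
(* rings, the zero ring included) and [{rmorphism R -> S}]; morphisms are     *)
(* compared pointwise.                                                        *)

Record ring_functor := RingFunctor {
  fobj :> pzRingType -> pzRingType;
  fmap : forall R S : pzRingType,
    {rmorphism R -> S} -> {rmorphism fobj R -> fobj S};
  fmap_ext : forall (R S : pzRingType) (f g : {rmorphism R -> S}),
    f =1 g -> fmap f =1 fmap g;
  fmap_id : forall R : pzRingType,
    fmap (idfun : {rmorphism R -> R}) =1 id;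
  fmap_comp : forall (R S T : pzRingType)
      (g : {rmorphism S -> T}) (f : {rmorphism R -> S}),
    fmap (g \o f : {rmorphism R -> T}) =1 fmap g \o fmap f
}.
Arguments fmap F {R S} f : rename.

Section FunctorComposition.
Variables G F : ring_functor.

Let cmap (R S : pzRingType) (f : {rmorphism R -> S}) :
  {rmorphism G (F R) -> G (F S)} := fmap G (fmap F f).

Fact functor_comp_ext (R S : pzRingType) (f g : {rmorphism R -> S}) :
  f =1 g -> cmap f =1 cmap g.
Proof. by move=> fg; apply: fmap_ext; apply: fmap_ext. Qed.

Fact functor_comp_id (R : pzRingType) :
  cmap (idfun : {rmorphism R -> R}) =1 id.
Proof.
move=> x; rewrite -[RHS](@fmap_id G (F R)).
by apply: fmap_ext; apply: fmap_id.
Qed.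

Fact functor_comp_comp (R S T : pzRingType)
    (g : {rmorphism S -> T}) (f : {rmorphism R -> S}) :
  cmap (g \o f : {rmorphism R -> T}) =1 cmap g \o cmap f.
Proof.
move=> x; rewrite -[RHS](@fmap_comp G _ _ _ (fmap F g) (fmap F f)).
by apply: fmap_ext; apply: fmap_comp.
Qed.

Definition functor_comp : ring_functor :=
  RingFunctor functor_comp_ext functor_comp_id functor_comp_comp.

End FunctorComposition.

Record natural_iso (F G : ring_functor) := NaturalIso {
  niso : forall R : pzRingType, {rmorphism F R -> G R};
  niso_inv : forall R : pzRingType, {rmorphism G R -> F R};
  nisoK : forall R : pzRingType, cancel (niso R) (niso_inv R);
  niso_invK : forall R : pzRingType, cancel (niso_inv R) (niso R);
  niso_natural : forall (R S : pzRingType) (f : {rmorphism R -> S}),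
    fmap G f \o niso R =1 niso S \o fmap F f
}.

Section DirectLimit.
Variables (M : nat -> pzRingType) (f : forall k, {rmorphism M k -> M k.+1}).

(* [thread x m] is the image of [x] at stage [m] when [tag x <= m] and is 0   *)
(* otherwise: [tagged_as] returns the (transported) element of [x] when the   *)
(* two stages agree, and its first argument when they do not.                 *)
Fixpoint thread (x : {k & M k}) (m : nat) : M m :=
  tagged_as (Tagged M (if m is m'.+1 return M m then f m' (thread x m') else 0))
            x.

Lemma thread_tag x : thread x (tag x) = tagged x.
Proof. by case: x => -[|k] x /=; rewrite tagged_asE. Qed.

Lemma threadS x m : (tag x <= m)%N -> thread x m.+1 = f m (thread x m).
Proof.
move=> le_xm; rewrite /= /tagged_as /=; case: eqP => // eq_xm.
by rewrite -eq_xm ltnn in le_xm.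
Qed.

Lemma thread_thread x m p : (tag x <= m)%N -> (m <= p)%N ->
  thread (Tagged M (thread x m)) p = thread x p.
Proof.
move=> le_xm /subnK<-; elim: (p - m)%N => [|d IHd].
  exact: (thread_tag (Tagged M (thread x m))).
by rewrite addSn !threadS ?IHd //= ?(leq_trans le_xm) ?leq_addl.
Qed.

Definition same_germ (x y : {k & M k}) : bool :=
  `[< exists m, [/\ (tag x <= m)%N, (tag y <= m)%N & thread x m = thread y m] >].

Lemma thread_eqW x y m p : (tag x <= m)%N -> (tag y <= m)%N -> (m <= p)%N ->
  thread x m = thread y m -> thread x p = thread y p.
Proof.
move=> lex ley lemp e.
by rewrite -(thread_thread lex lemp) e (thread_thread ley lemp).
Qed.

Fact same_germ_refl : reflexive same_germ.
Proof. by move=> x; apply/asboolP; exists (tag x). Qed.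

Fact same_germ_sym : symmetric same_germ.
Proof.
by move=> x y; apply/asboolP/asboolP=> -[m [lex ley e]]; exists m.
Qed.

Fact same_germ_trans : transitive same_germ.
Proof.
move=> y x z /asboolP[m [xm ym exy]] /asboolP[p [yp zp eyz]].
apply/asboolP; exists (maxn m p); split.
- by rewrite leq_max xm.
- by rewrite leq_max zp orbT.
rewrite (thread_eqW xm ym (leq_maxl m p) exy).
exact: (thread_eqW yp zp (leq_maxr m p) eyz).
Qed.

Canonical same_germ_equiv :=
  EquivRel same_germ same_germ_refl same_germ_sym same_germ_trans.

Definition dirlim := {eq_quot same_germ}.

HB.instance Definition _ := Choice.on dirlim.
HB.instance Definition _ : EqQuotient _ same_germ dirlim :=
  EqQuotient.on dirlim.

Definition in_dirlim k (x : M k) : dirlim := \pi_dirlim (Tagged M x).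

Lemma in_dirlimP k l (x : M k) (y : M l) :
  in_dirlim x = in_dirlim y <->
  exists m, [/\ (k <= m)%N, (l <= m)%N &
                thread (Tagged M x) m = thread (Tagged M y) m].
Proof.
rewrite /in_dirlim; split; first by move/eqmodP=> /asboolP.
by move=> h; apply/eqmodP/asboolP.
Qed.

Lemma in_dirlim_thread x m : (tag x <= m)%N ->
  in_dirlim (thread x m) = in_dirlim (tagged x).
Proof.
move=> xm; apply/in_dirlimP; exists m; split=> //.
by rewrite thread_thread //; case: x {xm}.
Qed.

Lemma in_dirlim_step k (x : M k) : in_dirlim (f k x) = in_dirlim x.
Proof.
have := @in_dirlim_thread (Tagged M x) k.+1 (leqnSn k).
by rewrite threadS // (thread_tag (Tagged M x)).
Qed.

Lemma in_dirlim_repr (a : dirlim) : in_dirlim (tagged (repr a)) = a.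
Proof. by rewrite /in_dirlim taggedK reprK. Qed.

Lemma thread_rep (a : dirlim) m : (tag (repr a) <= m)%N ->
  in_dirlim (thread (repr a) m) = a.
Proof. by move=> am; rewrite in_dirlim_thread // in_dirlim_repr. Qed.

Lemma dirlimP (a : dirlim) : exists m (x : M m), a = in_dirlim x.
Proof. by exists (tag (repr a)), (tagged (repr a)); rewrite in_dirlim_repr. Qed.

Lemma dirlimP2 (a b : dirlim) :
  exists m (x y : M m), a = in_dirlim x /\ b = in_dirlim y.
Proof.
pose m := maxn (tag (repr a)) (tag (repr b)).
exists m, (thread (repr a) m), (thread (repr b) m).
by rewrite !thread_rep ?leq_maxl ?leq_maxr.
Qed.

Lemma dirlimP3 (a b c : dirlim) : exists m (x y z : M m),
  [/\ a = in_dirlim x, b = in_dirlim y & c = in_dirlim z].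
Proof.
pose m := maxn (maxn (tag (repr a)) (tag (repr b))) (tag (repr c)).
exists m, (thread (repr a) m), (thread (repr b) m), (thread (repr c) m).
by rewrite !thread_rep // ?leq_maxr // !leq_max leqnn ?orbT.
Qed.

Definition lift2 (op : forall m, M m -> M m -> M m) (a b : dirlim) : dirlim :=
  let m := maxn (tag (repr a)) (tag (repr b)) in
  in_dirlim (op m (thread (repr a) m) (thread (repr b) m)).

Definition dirlim_zero : dirlim := in_dirlim (0 : M 0%N).
Definition dirlim_one : dirlim := in_dirlim (1 : M 0%N).
Definition dirlim_opp (a : dirlim) : dirlim := in_dirlim (- tagged (repr a)).
Definition dirlim_add : dirlim -> dirlim -> dirlim := lift2 (fun m => +%R).
Definition dirlim_mul : dirlim -> dirlim -> dirlim := lift2 (fun m => *%R).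

Lemma lift2E (op : forall m, M m -> M m -> M m) :
  (forall m, {morph f m : x y / op m x y >-> op m.+1 x y}) ->
  forall m (x y : M m),
    lift2 op (in_dirlim x) (in_dirlim y) = in_dirlim (op m x y).
Proof.
move=> fop m x y.
have thread_op k p (u v : M k) : (k <= p)%N ->
    thread (Tagged M (op k u v)) p =
    op p (thread (Tagged M u) p) (thread (Tagged M v) p).
  move=> /subnK<-; elim: (p - k)%N => [|d IHd].
    rewrite (thread_tag (Tagged M u)) (thread_tag (Tagged M v)).
    exact: (thread_tag (Tagged M (op k u v))).
  by rewrite addSn !threadS ?IHd ?fop //= leq_addl.
rewrite /lift2; set a := in_dirlim x; set b := in_dirlim y.
set n := maxn _ _.
have /in_dirlimP[p [np mp ex]] : in_dirlim (thread (repr a) n) = in_dirlim x.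
  by rewrite thread_rep ?leq_maxl.
have /in_dirlimP[q [nq mq ey]] : in_dirlim (thread (repr b) n) = in_dirlim y.
  by rewrite thread_rep ?leq_maxr.
apply/in_dirlimP; exists (maxn p q); split.
- by rewrite leq_max np.
- by rewrite leq_max mp.
rewrite !thread_op ?leq_max ?np ?mp //.
by congr (op _ _ _); [apply: thread_eqW ex | apply: thread_eqW ey];
  rewrite ?leq_maxl ?leq_maxr.
Qed.

Lemma dirlim_addE m (x y : M m) :
  dirlim_add (in_dirlim x) (in_dirlim y) = in_dirlim (x + y).
Proof. by apply: (@lift2E (fun m => +%R)) => k u v; rewrite rmorphD. Qed.

Lemma dirlim_mulE m (x y : M m) :
  dirlim_mul (in_dirlim x) (in_dirlim y) = in_dirlim (x * y).
Proof. by apply: (@lift2E (fun m => *%R)) => k u v; rewrite rmorphM. Qed.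

Lemma dirlim_zeroE m : dirlim_zero = in_dirlim (0 : M m).
Proof.
elim: m => [//|m ->].
by rewrite -[LHS]in_dirlim_step rmorph0.
Qed.

Lemma dirlim_oneE m : dirlim_one = in_dirlim (1 : M m).
Proof.
elim: m => [//|m ->].
by rewrite -[LHS]in_dirlim_step rmorph1.
Qed.

Fact dirlim_addA : associative dirlim_add.
Proof.
move=> a b c; have [m [x [y [z [-> -> ->]]]]] := dirlimP3 a b c.
by rewrite !dirlim_addE addrA.
Qed.

Fact dirlim_addC : commutative dirlim_add.
Proof.
move=> a b; have [m [x [y [-> ->]]]] := dirlimP2 a b.
by rewrite !dirlim_addE addrC.
Qed.

Fact dirlim_add0 : left_id dirlim_zero dirlim_add.
Proof.
move=> a; have [m [x ->]] := dirlimP a.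
by rewrite (dirlim_zeroE m) dirlim_addE add0r.
Qed.

Fact dirlim_addN : left_inverse dirlim_zero dirlim_opp dirlim_add.
Proof.
move=> a; rewrite -{2}(in_dirlim_repr a) dirlim_addE addNr.
by rewrite -dirlim_zeroE.
Qed.

Fact dirlim_mulA : associative dirlim_mul.
Proof.
move=> a b c; have [m [x [y [z [-> -> ->]]]]] := dirlimP3 a b c.
by rewrite !dirlim_mulE mulrA.
Qed.

Fact dirlim_mul1l : left_id dirlim_one dirlim_mul.
Proof.
move=> a; have [m [x ->]] := dirlimP a.
by rewrite (dirlim_oneE m) dirlim_mulE mul1r.
Qed.

Fact dirlim_mul1r : right_id dirlim_one dirlim_mul.
Proof.
move=> a; have [m [x ->]] := dirlimP a.
by rewrite (dirlim_oneE m) dirlim_mulE mulr1.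
Qed.

Fact dirlim_mulDl : left_distributive dirlim_mul dirlim_add.
Proof.
move=> a b c; have [m [x [y [z [-> -> ->]]]]] := dirlimP3 a b c.
by rewrite !(dirlim_mulE, dirlim_addE) mulrDl.
Qed.

Fact dirlim_mulDr : right_distributive dirlim_mul dirlim_add.
Proof.
move=> a b c; have [m [x [y [z [-> -> ->]]]]] := dirlimP3 a b c.
by rewrite !(dirlim_mulE, dirlim_addE) mulrDr.
Qed.

HB.instance Definition _ := GRing.isZmodule.Build dirlim
  dirlim_addA dirlim_addC dirlim_add0 dirlim_addN.
HB.instance Definition _ := GRing.Zmodule_isPzRing.Build dirlim
  dirlim_mulA dirlim_mul1l dirlim_mul1r dirlim_mulDl dirlim_mulDr.

Section Injections.
Variable k : nat.

Fact in_dirlim_is_zmod_morphism : zmod_morphism (@in_dirlim k).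
Proof.
move=> x y; apply: (canRL (addrK _)).
by rewrite -[LHS]/(dirlim_add _ _) dirlim_addE subrK.
Qed.

Fact in_dirlim_is_monoid_morphism : monoid_morphism (@in_dirlim k).
Proof.
split; first by rewrite -(dirlim_oneE k).
by move=> x y; rewrite -dirlim_mulE.
Qed.

HB.instance Definition _ := GRing.isZmodMorphism.Build (M k) dirlim
  (@in_dirlim k) in_dirlim_is_zmod_morphism.
HB.instance Definition _ := GRing.isMonoidMorphism.Build (M k) dirlim
  (@in_dirlim k) in_dirlim_is_monoid_morphism.

End Injections.

Section UniversalProperty.
Variables (T : pzRingType) (g : forall k, {rmorphism M k -> T}).
Hypothesis g_step : forall k (x : M k), g k.+1 (f k x) = g k x.

Definition dirlim_desc of (forall k (x : M k), g k.+1 (f k x) = g k x) :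
    dirlim -> T :=
  fun a => g (tag (repr a)) (tagged (repr a)).

Lemma dirlim_descE k (x : M k) : dirlim_desc g_step (in_dirlim x) = g k x.
Proof.
have g_thread y m : (tag y <= m)%N -> g m (thread y m) = g _ (tagged y).
  move=> /subnK<-; elim: (m - tag y)%N => [|d IHd]; first by rewrite thread_tag.
  by rewrite addSn threadS ?leq_addl // g_step IHd.
have /in_dirlimP[m [le1 le2 e]] := in_dirlim_repr (in_dirlim x).
have := congr1 (g m) e; rewrite taggedK (g_thread (Tagged M x)) // => <-.
by rewrite g_thread.
Qed.

Lemma dirlim_desc_unique (h : dirlim -> T) :
  (forall k (x : M k), h (in_dirlim x) = g k x) -> h =1 dirlim_desc g_step.
Proof.
by move=> hE a; have [m [x ->]] := dirlimP a; rewrite hE dirlim_descE.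
Qed.

Fact dirlim_desc_is_zmod_morphism : zmod_morphism (dirlim_desc g_step).
Proof.
move=> a b; have [m [x [y [-> ->]]]] := dirlimP2 a b.
by rewrite -rmorphB !dirlim_descE rmorphB.
Qed.

Fact dirlim_desc_is_monoid_morphism : monoid_morphism (dirlim_desc g_step).
Proof.
split; first by rewrite -(rmorph1 (@in_dirlim 0)) dirlim_descE rmorph1.
move=> a b; have [m [x [y [-> ->]]]] := dirlimP2 a b.
by rewrite -rmorphM !dirlim_descE rmorphM.
Qed.

HB.instance Definition _ := GRing.isZmodMorphism.Build dirlim T
  (dirlim_desc g_step) dirlim_desc_is_zmod_morphism.
HB.instance Definition _ := GRing.isMonoidMorphism.Build dirlim T
  (dirlim_desc g_step) dirlim_desc_is_monoid_morphism.

End UniversalProperty.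

End DirectLimit.

Arguments in_dirlim {M} f k x.
Arguments dirlim_desc {M f T} g _ _ : simpl never.

Section MatricialClosure.
Variable n : nat.

Definition eta (R : pzRingType) (a : R) : 'M[R]_n := a%:M.

(* The identification of M_n(M_m(R)) with M_{nm}(R) by blocks; the library's  *)
(* block matrices have size [\sum_(i < n) m], whence the cast.                *)
Definition flatten_mx (R : pzRingType) (m p : nat)
    (e : (\sum_(i < n) m)%N = p) (B : 'M['M[R]_m]_n) : 'M[R]_p :=
  castmx (e, e) (\mxblock_(i < n, j < n) B i j).

Lemma sum_expn k : (\sum_(i < n) n ^ k)%N = (n ^ k.+1)%N.
Proof. by rewrite sum_nat_const card_ord expnS. Qed.

Definition connect_mx (R : pzRingType) (k : nat) (A : 'M[R]_(n ^ k)) :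
    'M[R]_(n ^ k.+1) :=
  flatten_mx (sum_expn k) (eta A).

Section Flatten.
Variables (R : pzRingType) (m p : nat) (e : (\sum_(i < n) m)%N = p).

Fact flatten_mx_is_zmod_morphism : zmod_morphism (@flatten_mx R m p e).
Proof.
case: p / e => A B; rewrite /flatten_mx !castmx_id -mxblockB.
by apply/eq_mxblockP=> i j; rewrite !mxE.
Qed.

Fact flatten_mx_is_monoid_morphism : monoid_morphism (@flatten_mx R m p e).
Proof.
case: p / e; rewrite /flatten_mx; split=> [|A B]; rewrite !castmx_id.
  rewrite -[RHS]mxdiagZ; apply/eq_mxblock => i j.
  by rewrite mxE -/(i == j); case: eqP => // _; rewrite conform_mx_id.
rewrite -[RHS]/(_ *m _) mul_mxblock; apply/eq_mxblock => i j.
by rewrite mxE.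
Qed.

Lemma flatten_mx_bij : bijective (@flatten_mx R m p e).
Proof.
case: p / e; pose blk (A : 'M[R]_(\sum_(i < n) m)) i j : 'M[R]_m :=
  submxblock (p_ := fun=> m) (q_ := fun=> m) A i j.
exists (fun A => \matrix_(i, j) blk A i j) => A.
  apply/matrixP => i j.
  by rewrite /flatten_mx castmx_id mxE /blk mxblockK.
rewrite /flatten_mx castmx_id -[RHS]submxblockK.
by apply/eq_mxblock => i j; rewrite mxE.
Qed.

HB.instance Definition _ := GRing.isZmodMorphism.Build 'M['M[R]_m]_n 'M[R]_p
  (@flatten_mx R m p e) flatten_mx_is_zmod_morphism.
HB.instance Definition _ := GRing.isMonoidMorphism.Build 'M['M[R]_m]_n 'M[R]_p
  (@flatten_mx R m p e) flatten_mx_is_monoid_morphism.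

End Flatten.

HB.instance Definition _ (R : pzRingType) :=
  GRing.RMorphism.copy (@eta R) (@scalar_mx R n).

Section Connect.
Variables (R : pzRingType) (k : nat).

HB.instance Definition _ := GRing.RMorphism.copy (@connect_mx R k)
  (@flatten_mx R (n ^ k) (n ^ k.+1) (sum_expn k) \o @eta 'M[R]_(n ^ k)).

Lemma connect_mxE (A : 'M[R]_(n ^ k)) :
  connect_mx A = castmx (sum_expn k, sum_expn k) (\mxdiag_(i < n) A).
Proof.
rewrite /connect_mx /flatten_mx; congr castmx; apply/eq_mxblock => i j.
by rewrite mxE; case: eqP => // _; rewrite conform_mx_id.
Qed.

Lemma connect_map_mx (S : pzRingType) (f : {rmorphism R -> S})
    (A : 'M[R]_(n ^ k)) :
  connect_mx (map_mx f A) = map_mx f (connect_mx A).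
Proof.
rewrite /connect_mx /flatten_mx map_castmx; congr castmx.
apply/matrixP=> i j; rewrite !mxE.
by case: eqP => _; rewrite ?mulr1n ?mulr0n !mxE ?rmorph0.
Qed.

End Connect.

Definition MCstage (R : pzRingType) (k : nat) : pzRingType := 'M[R]_(n ^ k).

Definition MCconnect (R : pzRingType) (k : nat) :
    {rmorphism MCstage R k -> MCstage R k.+1} := @connect_mx R k.

Definition MCring (R : pzRingType) : pzRingType := dirlim (MCconnect R).

Definition MCin (R : pzRingType) (k : nat) :
    {rmorphism MCstage R k -> MCring R} := in_dirlim (MCconnect R) k.

Section Map.
Variables (R S : pzRingType) (f : {rmorphism R -> S}).

Definition MCin_map k : {rmorphism 'M[R]_(n ^ k) -> MCring S} :=
  MCin S k \o map_mx f.

Fact MCin_map_step k (A : 'M[R]_(n ^ k)) :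
  MCin_map k.+1 (connect_mx A) = MCin_map k A.
Proof. by rewrite /= -connect_map_mx; apply: in_dirlim_step. Qed.

Definition MCmap : {rmorphism MCring R -> MCring S} :=
  dirlim_desc MCin_map MCin_map_step.

Lemma MCmapE k (A : 'M[R]_(n ^ k)) : MCmap (MCin R k A) = MCin S k (map_mx f A).
Proof. exact: (dirlim_descE MCin_map_step). Qed.

Lemma MCmap_unique (h : {rmorphism MCring R -> MCring S}) :
  (forall k (A : 'M[R]_(n ^ k)), h (MCin R k A) = MCin S k (map_mx f A)) ->
  h =1 MCmap.
Proof. exact: (dirlim_desc_unique MCin_map_step). Qed.

End Map.

Lemma MCringP (R : pzRingType) (a : MCring R) :
  exists k (A : 'M[R]_(n ^ k)), a = MCin R k A.
Proof. exact: dirlimP. Qed.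

Fact MCmap_ext (R S : pzRingType) (f g : {rmorphism R -> S}) :
  f =1 g -> MCmap f =1 MCmap g.
Proof.
move=> fg a; have [k [A ->]] := MCringP a; rewrite !MCmapE.
by rewrite (eq_map_mx _ fg).
Qed.

Fact MCmap_id (R : pzRingType) : MCmap (idfun : {rmorphism R -> R}) =1 id.
Proof.
move=> a; have [k [A ->]] := MCringP a; rewrite MCmapE.
by rewrite map_mx_id.
Qed.

Fact MCmap_comp (R S T : pzRingType)
    (g : {rmorphism S -> T}) (f : {rmorphism R -> S}) :
  MCmap (g \o f : {rmorphism R -> T}) =1 MCmap g \o MCmap f.
Proof.
move=> a; have [k [A ->]] := MCringP a; rewrite -[RHS]/(MCmap g (MCmap f _)).
by rewrite !MCmapE map_mx_comp.
Qed.

Definition MC : ring_functor := RingFunctor MCmap_ext MCmap_id MCmap_comp.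

End MatricialClosure.

(* Main.v *)
(* Write M_n for n x n matrices over the integers.  Then MC_n(R) is R         *)
(* tensored with infinitely many copies of M_n, one for each base-n digit of  *)
(* a row index, so MC_n(MC_n(R)) is R tensored with two such families.        *)
(* Sending the digits of even position to the outer closure and those of odd  *)
(* position to the inner one identifies M_{n^m}(R) with M_{n^p}(M_{n^q}(R)),  *)
(* p and q being m/2 rounded up and down; this commutes with the connecting   *)
(* maps because a new digit is always the most significant one.  Bijectivity  *)
(* in the limit holds because the stages (p, q) with p = q are cofinal in the *)
(* double system.                                                             *)

From HB Require Import structures.
Require Import Defs.
From mathcomp Require Import all_boot all_order all_algebra.
From mathcomp Require Import boolp.

Set Implicit Arguments.
Unset Strict Implicit.
Unset Printing Implicit Defensive.

Import GRing.Theory.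
Local Open Scope ring_scope.

(** At each stage, [MCdouble_stage] regroups a matrix of size n^m along the bijection [weave_ord]
    and applies the two canonical maps. These agree across stages by [MCdouble_stage_step], so they
    induce [MCdouble] on the limit. It is injective because for n > 0 all canonical maps are
    ([MCin_inj]). It is surjective because the finitely many entries of a matrix live at one inner
    stage, and both indices can be raised to a common q, which m = 2q reaches ([MCdouble_surj]).
    Regrouping only moves entries, whence naturality. *)

(** * Representatives in a direct limit *)

Section DirectLimitFacts.
Variables (M : nat -> pzRingType) (f : forall k, {rmorphism M k -> M k.+1}).

Lemma in_dirlim_inj (k : nat) :
  (forall m, injective (f m)) -> injective (in_dirlim f k).
Proof.
move=> f_inj x y /in_dirlimP[m [km _]]; rewrite -(subnK km).
elim: (m - k)%N => [|d IHd].
  by rewrite (thread_tag f (Tagged M x)) (thread_tag f (Tagged M y)).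
by rewrite addSn !threadS ?leq_addl // => /f_inj.
Qed.

Lemma in_dirlim_raise (k m : nat) (x : M k) :
  (k <= m)%N -> exists y : M m, in_dirlim f k x = in_dirlim f m y.
Proof.
by move=> km; exists (thread f (Tagged M x) m); rewrite in_dirlim_thread.
Qed.

(** Serves to lift all entries of a matrix over the limit at once; the bound [m] makes the inner
    stage at least the outer one. *)
Lemma in_dirlim_common (I : finType) (a : I -> dirlim f) (m : nat) :
  exists2 p, (m <= p)%N &
    exists x : I -> M p, forall i, a i = in_dirlim f p (x i).
Proof.
pose p := maxn m (\max_i tag (repr (a i))).
exists p; first exact: leq_maxl.
exists (fun i => thread f (repr (a i)) p) => i; rewrite thread_rep //.
by rewrite leq_max (leq_bigmax i) orbT.
Qed.

End DirectLimitFacts.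

(** * Matrices regrouped into matrices of matrices *)

Section Nest.
Variables (R : pzRingType) (p q r : nat) (h : 'I_p * 'I_q -> 'I_r).

(** The proof of bijectivity is an argument so that the ring morphism structure can be inferred from
    the term. *)
Definition nest_mx of bijective h := fun A : 'M[R]_r =>
  \matrix_(i < p, j < p) \matrix_(u < q, v < q) A (h (i, u)) (h (j, v)).

Variable h_bij : bijective h.

Fact nest_mx_is_zmod_morphism : zmod_morphism (nest_mx h_bij).
Proof. by move=> A B; do 2!apply/matrixP => ? ?; rewrite !mxE. Qed.

Fact nest_mx_is_monoid_morphism : monoid_morphism (nest_mx h_bij).
Proof.
split=> [|A B]; apply/matrixP => i j; apply/matrixP => u v; rewrite !mxE.
  rewrite (inj_eq (bij_inj h_bij)) xpair_eqE.
  by case: (i == j); rewrite !mxE ?mulr0n.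
(* Summation along [h] splits the product into the outer and the inner matrix product. *)
rewrite (reindex h) /=; last by apply: onW_bij.
rewrite (eq_bigr (fun x => A (h (i, u)) (h (x.1, x.2)) *
  B (h (x.1, x.2)) (h (j, v)))); last by case.
rewrite summxE -(pair_bigA _ (fun k w => A (h (i, u)) (h (k, w)) *
  B (h (k, w)) (h (j, v)))) /=.
by apply: eq_bigr => k _; rewrite !mxE; apply: eq_bigr => w _; rewrite !mxE.
Qed.

HB.instance Definition _ := GRing.isZmodMorphism.Build 'M[R]_r 'M['M[R]_q]_p
  (nest_mx h_bij) nest_mx_is_zmod_morphism.
HB.instance Definition _ := GRing.isMonoidMorphism.Build 'M[R]_r 'M['M[R]_q]_p
  (nest_mx h_bij) nest_mx_is_monoid_morphism.

Lemma nest_mx_bij : bijective (nest_mx h_bij).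
Proof.
have [g hK gK] := h_bij.
exists (fun B : 'M['M[R]_q]_p =>
  \matrix_(s, t) B (g s).1 (g t).1 (g s).2 (g t).2) => A.
  by apply/matrixP => s t; rewrite !mxE -!surjective_pairing !gK.
by do 2!apply/matrixP => ? ?; rewrite !mxE !hK.
Qed.

End Nest.

Lemma map_nest_mx (R S : pzRingType) (f : {rmorphism R -> S}) (p q r : nat)
    (h : 'I_p * 'I_q -> 'I_r) (h_bij : bijective h) (A : 'M[R]_r) :
  nest_mx h_bij (map_mx f A) = map_mx (map_mx f) (nest_mx h_bij A).
Proof. by do 2!apply/matrixP => ? ?; rewrite !mxE. Qed.

(** * Entries of the connecting maps *)

(** In a block diagonal matrix the leading digit of an index selects the block and the remainder the
    place inside it. *)
Lemma connect_mx_entry (n : nat) (R : pzRingType) (k : nat) (A : 'M[R]_(n ^ k))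
    (i j : 'I_(n ^ k.+1)) (i' j' : 'I_(n ^ k)) :
    i' = (i %% n ^ k)%N :> nat -> j' = (j %% n ^ k)%N :> nat ->
  connect_mx A i j = A i' j' *+ (i %/ n ^ k == j %/ n ^ k)%N.
Proof.
rewrite /connect_mx /flatten_mx castmxE mxE /=.
set s := cast_ord _ i; set t := cast_ord _ j.
have tagE (w : 'I_(\sum_(x < n) n ^ k)) :
    (tagnat.sig1 w : nat) = (w %/ n ^ k)%N /\
    (tagnat.sig2 w : nat) = (w %% n ^ k)%N.
  have lt2 := ltn_ord (tagnat.sig2 w).
  have pos : (0 < n ^ k)%N by apply: leq_ltn_trans lt2.
  have -> : (w : nat) = (tagnat.sig1 w * n ^ k + tagnat.sig2 w)%N.
    rewrite [LHS](tagnat.rect w) (big_ord_narrow (ltnW (ltn_ord _))).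
    by rewrite sum_nat_const card_ord.
  by rewrite divnMDl // modnMDl divn_small // modn_small // addn0.
have [s1 s2] := tagE s; have [t1 t2] := tagE t.
move=> ei ej; have -> : i' = tagnat.sig2 s by apply: val_inj; rewrite /= s2.
have -> : j' = tagnat.sig2 t by apply: val_inj; rewrite /= t2.
rewrite mxE -val_eqE /= s1 t1.
by case: eqP; rewrite ?mxE.
Qed.

Lemma connect_mx_inj (n : nat) (R : pzRingType) (k : nat) :
  (0 < n)%N -> injective (@connect_mx n R k).
Proof.
move=> n_gt0 A B /matrixP eAB; apply/matrixP => i j.
(* The top left block of the image is the matrix itself. *)
have le_k : (n ^ k <= n ^ k.+1)%N by rewrite expnS leq_pmull.
have := eAB (widen_ord le_k i) (widen_ord le_k j).
rewrite !(connect_mx_entry _ (i' := i) (j' := j)) /= ?modn_small //.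
by rewrite !divn_small.
Qed.

Lemma MCin_inj (n : nat) (R : pzRingType) (k : nat) :
  (0 < n)%N -> injective (MCin n R k).
Proof. by move=> n_gt0; apply: in_dirlim_inj => m; apply: connect_mx_inj. Qed.

(** * Interleaving of base-n digits *)

(* The number below [n ^ m] whose base-[n] digits of even position are those  *)
(* of [i] and whose digits of odd position are those of [u]; the recursion    *)
(* strips the most significant digit, the one that [connect_mx] adds.         *)
Fixpoint weave (n m i u : nat) : nat :=
  if m isn't m'.+1 then 0 else
  let b := (n ^ m'./2)%N in
  if odd m' then (u %/ b * n ^ m' + weave n m' i (u %% b))%N
  else (i %/ b * n ^ m' + weave n m' (i %% b) u)%N.

Lemma uphalf_even m : ~~ odd m -> uphalf m = m./2.
Proof. by rewrite uphalf_half => /negbTE->. Qed.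

Lemma uphalf_odd m : odd m -> uphalf m = m./2.+1.
Proof. by rewrite uphalf_half => ->. Qed.

Section Weave.
Variable n : nat.
Hypothesis n_gt0 : (0 < n)%N.

Lemma weave_lt m i u :
  (i < n ^ uphalf m)%N -> (u < n ^ m./2)%N -> (weave n m i u < n ^ m)%N.
Proof.
have digit_lt d b x : (d < n)%N -> (x < b)%N -> (d * b + x < n * b)%N.
  move=> dn xb; apply: (@leq_trans (d.+1 * b));
    last by rewrite leq_pmul2r // (leq_ltn_trans _ xb).
  by rewrite mulSn addnC ltn_add2r.
elim: m i u => [|m IHm] i u //=.
have pos : (0 < n ^ m./2)%N by rewrite expn_gt0 n_gt0.
case: ifP => [odd_m | /negbT even_m] lt_i lt_u; rewrite expnS; apply: digit_lt.
- by rewrite ltn_divLR // -expnS -uphalf_odd.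
- by rewrite IHm ?ltn_pmod // uphalf_odd.
- by rewrite ltn_divLR // -expnS.
- by rewrite IHm ?uphalf_even ?ltn_pmod // -uphalf_even.
Qed.

Lemma weave_inj m i u j v :
    (i < n ^ uphalf m)%N -> (u < n ^ m./2)%N ->
    (j < n ^ uphalf m)%N -> (v < n ^ m./2)%N ->
  weave n m i u = weave n m j v -> i = j /\ u = v.
Proof.
elim: m i u j v => [|m IHm] i u j v /=.
  by rewrite !ltnS !leqn0 => /eqP-> /eqP-> /eqP-> /eqP->.
have pos : (0 < n ^ m./2)%N by rewrite expn_gt0 n_gt0.
have digit_eq d x e y : (x < n ^ m)%N -> (y < n ^ m)%N ->
    (d * n ^ m + x = e * n ^ m + y)%N -> d = e /\ x = y.
  move=> lx ly E; have b0 := leq_ltn_trans (leq0n x) lx.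
  by split; [move/(congr1 (divn^~ (n ^ m)%N)): E |
             move/(congr1 (modn^~ (n ^ m)%N)): E];
    rewrite ?divnMDl ?modnMDl ?divn_small ?modn_small ?addn0.
case: ifP => [odd_m | /negbT even_m] li lu lj lv.
- have ld w : (w %% n ^ m./2 < n ^ m./2)%N by rewrite ltn_pmod.
  case/digit_eq; try by rewrite weave_lt // uphalf_odd.
  move=> ed /IHm[]; rewrite ?uphalf_odd // => -> em.
  by rewrite (divn_eq u (n ^ m./2)) (divn_eq v (n ^ m./2)) ed em.
- have ld w : (w %% n ^ m./2 < n ^ uphalf m)%N by rewrite uphalf_even ?ltn_pmod.
  rewrite (uphalf_even even_m) in lu lv.
  case/digit_eq; try by rewrite weave_lt.
  move=> ed /IHm[] // em ->.
  by rewrite (divn_eq i (n ^ m./2)) (divn_eq j (n ^ m./2)) ed em.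
Qed.

(** Sizes enter through equations, so that m = 2q can be used with p = q without casting
    matrices. *)
Definition weave_ord (m p q : nat) (ep : uphalf m = p) (eq : m./2 = q)
    (x : 'I_(n ^ p) * 'I_(n ^ q)) : 'I_(n ^ m) :=
  Ordinal (weave_lt
    (etrans (congr1 (fun z => x.1 < n ^ z)%N ep) (ltn_ord x.1))
    (etrans (congr1 (fun z => x.2 < n ^ z)%N eq) (ltn_ord x.2))).

(** Injectivity suffices, by counting: the two halves of m add up to m. *)
Lemma weave_ord_bij m p q (ep : uphalf m = p) (eq : m./2 = q) :
  bijective (weave_ord ep eq).
Proof.
apply: inj_card_bij => [[i u] [j v] /(congr1 val)/= e|].
  have [|||| ei eu] := weave_inj _ _ _ _ e; rewrite ?ep ?eq //.
  by congr pair; apply: val_inj.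
rewrite card_prod !card_ord -expnD -ep -eq uphalf_half -addnA addnn.
by rewrite odd_double_half.
Qed.

(** * The comparison map and its inverse *)

Section Stage.
Variable R : pzRingType.

Definition MCdouble_stage m p q (ep : uphalf m = p) (eq : m./2 = q) :
    {rmorphism 'M[R]_(n ^ m) -> MCring n (MCring n R)} :=
  MCin n (MCring n R) p \o
    (map_mx (MCin n R q) \o nest_mx (weave_ord_bij ep eq)).

Lemma MCdouble_stage_step m p q p' q' (ep : uphalf m = p) (eq : m./2 = q)
    (ep' : uphalf m.+1 = p') (eq' : (m.+1)./2 = q') (A : 'M[R]_(n ^ m)) :
  MCdouble_stage ep' eq' (connect_mx A) = MCdouble_stage ep eq A.
Proof.
have pos : (0 < n ^ m./2)%N by rewrite expn_gt0 n_gt0.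
have posm : (0 < n ^ m)%N by rewrite expn_gt0 n_gt0.
have W_div d (s : 'I_(n ^ m)) : ((d * n ^ m + s) %/ n ^ m = d)%N.
  by rewrite divnMDl // divn_small ?addn0.
have W_mod d (s : 'I_(n ^ m)) : ((d * n ^ m + s) %% n ^ m = s)%N.
  by rewrite modnMDl modn_small.
rewrite /MCdouble_stage /=.
have [odd_m | even_m] := boolP (odd m).
(* The new digit has odd position: the connecting map acts inside each entry and is absorbed by the
   inner limit. *)
- have pp : p' = p by rewrite -ep -ep' [RHS]uphalf_odd.
  have qq : q' = q.+1 by rewrite -eq -eq' /= uphalf_odd.
  move: ep' eq'; rewrite pp qq => ep' eq'.
  apply: (congr1 (in_dirlim (MCconnect n (MCring n R)) p)).
  rewrite [X in map_mx _ X](_ : _ =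
    map_mx (@connect_mx n R q) (nest_mx (weave_ord_bij ep eq) A)).
    by rewrite -map_mx_comp; apply: eq_map_mx => B; apply: in_dirlim_step.
  apply/matrixP => i j; apply/matrixP => u v.
  have lq (w : 'I_(n ^ q.+1)) : (w %% n ^ q < n ^ q)%N
    by rewrite ltn_pmod // -eq.
  rewrite !mxE.
  rewrite (connect_mx_entry _ (i' := Ordinal (lq u)) (j' := Ordinal (lq v))) //.
  pose wi := weave_ord ep eq (i, Ordinal (lq u)).
  pose wj := weave_ord ep eq (j, Ordinal (lq v)).
  rewrite (connect_mx_entry _ (i' := wi) (j' := wj)) /= odd_m eq.
  + by rewrite !mxE (W_div _ wi) (W_div _ wj).
  + by rewrite (W_mod _ wi).
  + by rewrite (W_mod _ wj).
(* The new digit has even position: the outer matrix becomes block diagonal, which the outer limit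
   absorbs. *)
- have pp : p' = p.+1 by rewrite -ep -ep' /= uphalf_even.
  have qq : q' = q by rewrite -eq -eq' /= uphalf_even.
  have pE : p = m./2 by rewrite -ep uphalf_even.
  move: ep' eq'; rewrite pp qq => ep' eq'.
  rewrite [X in map_mx _ X](_ : _ =
    connect_mx (nest_mx (weave_ord_bij ep eq) A)).
    by rewrite -(connect_map_mx (MCin n R q)); apply: in_dirlim_step.
  apply/matrixP => i j; apply/matrixP => u v.
  have lp (w : 'I_(n ^ p.+1)) : (w %% n ^ p < n ^ p)%N
    by rewrite ltn_pmod // pE.
  rewrite !mxE.
  rewrite (connect_mx_entry _ (i' := Ordinal (lp i)) (j' := Ordinal (lp j))) //.
  pose wi := weave_ord ep eq (Ordinal (lp i), u).
  pose wj := weave_ord ep eq (Ordinal (lp j), v).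
  rewrite (connect_mx_entry _ (i' := wi) (j' := wj)) /= (negbTE even_m) -pE.
  + by rewrite !mxE (W_div _ wi) (W_div _ wj); case: eqP; rewrite !mxE.
  + by rewrite (W_mod _ wi).
  + by rewrite (W_mod _ wj).
Qed.

Definition MCdouble : {rmorphism MCring n R -> MCring n (MCring n R)} :=
  dirlim_desc (fun m => MCdouble_stage (erefl (uphalf m)) (erefl m./2))
    (fun m => MCdouble_stage_step (erefl _) (erefl _) (erefl _) (erefl _)).

Lemma MCdoubleE m p q (ep : uphalf m = p) (eq : m./2 = q) (A : 'M[R]_(n ^ m)) :
  MCdouble (MCin n R m A) =
  MCin n (MCring n R) p (map_mx (MCin n R q) (nest_mx (weave_ord_bij ep eq) A)).
Proof. by case: p / ep; case: q / eq; apply: dirlim_descE. Qed.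

Lemma MCdouble_inj : injective MCdouble.
Proof.
move=> a b; have [m [A [B [-> ->]]]] := dirlimP2 a b.
rewrite !(MCdoubleE (erefl _) (erefl _)) => /(MCin_inj n_gt0) e.
apply: (congr1 (MCin n R m)).
have w_bij := weave_ord_bij (erefl (uphalf m)) (erefl m./2).
apply: (bij_inj (nest_mx_bij R w_bij)).
apply/matrixP => i j; apply: (MCin_inj n_gt0).
by have /matrixP/(_ i j) := e; rewrite [LHS]mxE [RHS]mxE.
Qed.

Lemma MCdouble_surj b : exists a, MCdouble a = b.
Proof.
have [p [B ->]] := MCringP b.
have [q le_pq [x Bx]] := in_dirlim_common (fun ij => B ij.1 ij.2) p.
pose C : 'M['M[R]_(n ^ q)]_(n ^ p) := \matrix_(i, j) x (i, j).
have -> : B = map_mx (MCin n R q) C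
  by apply/matrixP => i j; rewrite mxE [C i j]mxE; apply: (Bx (i, j)).
(* The outer stage is raised over the ring of matrices of size n^q; [MCmap] later carries [CD] to
   the double closure. *)
have [D CD] := in_dirlim_raise (MCconnect n (MCstage n R q)) C le_pq.
have ep : uphalf q.*2 = q by rewrite uphalf_double.
have eq : q.*2./2 = q by rewrite doubleK.
have [unnest _ unnestK] := nest_mx_bij R (weave_ord_bij ep eq).
exists (MCin n R q.*2 (unnest D)); rewrite (MCdoubleE ep eq) unnestK.
by rewrite -!MCmapE; apply: (congr1 (MCmap n _)).
Qed.

Definition MCdouble_inv (b : MCring n (MCring n R)) : MCring n R :=
  sval (cid (MCdouble_surj b)).

Lemma MCdouble_invK : cancel MCdouble_inv MCdouble.
Proof. by move=> b; apply: svalP (cid (MCdouble_surj b)). Qed.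

Lemma MCdoubleK : cancel MCdouble MCdouble_inv.
Proof. exact: inj_can_sym MCdouble_invK MCdouble_inj. Qed.

HB.instance Definition _ := GRing.isZmodMorphism.Build _ _ MCdouble_inv
  (can2_zmod_morphism MCdoubleK MCdouble_invK).
HB.instance Definition _ := GRing.isMonoidMorphism.Build _ _ MCdouble_inv
  (can2_monoid_morphism MCdoubleK MCdouble_invK).

End Stage.

Lemma MCdouble_natural (R S : pzRingType) (f : {rmorphism R -> S}) :
  MCmap n (MCmap n f) \o MCdouble R =1 MCdouble S \o MCmap n f.
Proof.
move=> a; have [m [A ->]] := MCringP a.
rewrite -[LHS]/(MCmap n _ (MCdouble R _)) -[RHS]/(MCdouble S (MCmap n f _)).
rewrite MCmapE !(MCdoubleE (erefl _) (erefl _)) MCmapE map_nest_mx.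
apply: (congr1 (MCin n _ _)).
by apply/matrixP => i j; rewrite 2!mxE [RHS]mxE [in RHS]mxE; apply: MCmapE.
Qed.

End Weave.

Theorem proposition6 (n : nat) :
  (0 < n)%N -> inhabited (natural_iso (MC n) (functor_comp (MC n) (MC n))).
Proof.
move=> n_gt0; constructor.
exact: (@NaturalIso (MC n) (functor_comp (MC n) (MC n))
  (MCdouble n_gt0) (fun R => MCdouble_inv n_gt0 (R := R))
  (@MCdoubleK n n_gt0) (@MCdouble_invK n n_gt0) (@MCdouble_natural n n_gt0)).
Qed.
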